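(* Let $d,d'$ be positive integers, let $\alpha_d=\dfrac{\Gamma(d/2)}{\sqrt{\pi}\,\Gamma((d+1)/2)}$, and for a function $\alpha$ put $$\varphi_{d,d'}(x,t)=\frac{1+\alpha(t)\left(\frac12-\alpha_d x\right)}{1+\frac{\alpha(0)}{2}},$$ with $x\in[0,1)$ and $t$ in the domain of $\alpha$. If $\alpha\in\mathcal{P}(\mathbb{R}^{d'},\|\cdot\|)$, then $\varphi_{d,d'}\in\mathcal{P}(\mathbb{B}_d\times\mathbb{R}^{d'},\|\cdot\|,\|\cdot\|)$. If $\alpha\in\mathcal{P}(\mathbb{S}^{d'},\theta)$, then $\varphi_{d,d'}\in\mathcal{P}(\mathbb{B}_d\times\mathbb{S}^{d'},\|\cdot\|,\theta)$.
   Context: $\|\cdot\|$ is the Euclidean norm and $\mathbb{B}_d=\{\boldsymbol{x}\in\mathbb{R}^d:\|\boldsymbol{x}\|<1/2\}$. $\mathbb{S}^{d'}$ is the unit sphere of $\mathbb{R}^{d'+1}$, with geodesic distance $\theta(\boldsymbol{s},\boldsymbol{s}')=\arccos\langle\boldsymbol{s},\boldsymbol{s}'\rangle$. A kernel $K:X\times X\to\mathbb{R}$ is positive definite if $\sum_{i,j=1}^N a_ia_jK(p_i,p_j)\ge0$ for all $N\in\mathbb{N}$, $a_1,\dots,a_N\in\mathbb{R}$ and $p_1,\dots,p_N\in X$. $\mathcal{P}(\mathbb{R}^{d'},\|\cdot\|)$: continuous $f:[0,\infty)\to\mathbb{R}$ with $f(0)=1$ such that $(\boldsymbol{y},\boldsymbol{y}')\mapsto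 f(\|\boldsymbol{y}-\boldsymbol{y}'\|)$ is positive definite on $\mathbb{R}^{d'}$. $\mathcal{P}(\mathbb{S}^{d'},\theta)$: continuous $f:[0,\pi]\to\mathbb{R}$ with $f(0)=1$ such that $(\boldsymbol{s},\boldsymbol{s}')\mapsto f(\theta(\boldsymbol{s},\boldsymbol{s}'))$ is positive definite on $\mathbb{S}^{d'}$. $\mathcal{P}(\mathbb{B}_d\times\mathbb{R}^{d'},\|\cdot\|,\|\cdot\|)$: continuous $\varphi:[0,1)\times[0,\infty)\to\mathbb{R}$ with $\varphi(0,0)=1$ such that $((\boldsymbol{x},\boldsymbol{y}),(\boldsymbol{x}',\boldsymbol{y}'))\mapsto\varphi(\|\boldsymbol{x}-\boldsymbol{x}'\|,\|\boldsymbol{y}-\boldsymbol{y}'\|)$ is positive definite on $\mathbb{B}_d\times\mathbb{R}^{d'}$. $\mathcal{P}(\mathbb{B}_d\times\mathbb{S}^{d'},\|\cdot\|,\theta)$: continuous $\psi:[0,1)\times[0,\pi]\to\mathbb{R}$ with $\psi(0,0)=1$ such that $((\boldsymbol{x},\boldsymbol{s}),(\boldsymbol{x}',\boldsymbol{s}'))\mapsto\psi(\|\boldsymbol{x}-\boldsymbol{x}'\|,\theta(\boldsymbol{s},\boldsymbol{s}'))$ is positive definite on $\mathbb{B}_d\times\mathbb{S}^{d'}$. *)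

(* Defs.v *)
From mathcomp Require Import all_boot all_order all_algebra.
From mathcomp Require Import all_classical all_reals all_analysis.

Set Implicit Arguments.
Unset Strict Implicit.
Unset Printing Implicit Defensive.

Import Order.TTheory GRing.Theory Num.Theory.
Import numFieldNormedType.Exports.

Local Open Scope classical_set_scope.
Local Open Scope ring_scope.

Definition inner {R : realType} {n : nat} (u v : 'rV[R]_n) : R :=
  \sum_(i < n) u ord0 i * v ord0 i.

(* The library norm on 'rV[R]_n is the sup norm, hence a separate
   Euclidean norm. *)
Definition enorm {R : realType} {n : nat} (u : 'rV[R]_n) : R :=
  Num.sqrt (inner u u).

Definition edist {R : realType} {n : nat} (u v : 'rV[R]_n) : R :=
  enorm (u - v).

Definition half_ball (R : realType) (d : nat) : set 'rV[R]_d :=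
  [set x | enorm x < 1 / 2].
Arguments half_ball : clear implicits.

Definition sphere (R : realType) (n : nat) : set 'rV[R]_n.+1 :=
  [set s | enorm s = 1].
Arguments sphere : clear implicits.

Definition geodist {R : realType} {n : nat} (s s' : 'rV[R]_n) : R :=
  acos (inner s s').

(* Only the values of K on X * X are relevant. *)
Definition positive_definite {R : realType} {T : Type} (X : set T)
    (K : T -> T -> R) : Prop :=
  forall (N : nat) (a : 'I_N -> R) (p : 'I_N -> T), (forall i, X (p i)) ->
    0 <= \sum_(i < N) \sum_(j < N) a i * a j * K (p i) (p j).

(* In the four classes below a function on an interval, or on a product of two
   intervals, is represented by a total function of which only the values on
   that domain matter; {within D, continuous _} is continuity for the subspace
   topology of D. *)
Definition P_euclid {R : realType} (d' : nat) (f : R -> R) : Prop :=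
  [/\ {within `[0, +oo[, continuous f},
      f 0 = 1 &
      positive_definite [set: 'rV[R]_d'] (fun y y' => f (edist y y'))].

Definition P_sphere {R : realType} (d' : nat) (f : R -> R) : Prop :=
  [/\ {within `[0, pi], continuous f},
      f 0 = 1 &
      positive_definite (sphere R d') (fun s s' => f (geodist s s'))].

Definition P_ball_euclid {R : realType} (d d' : nat) (phi : R -> R -> R)
    : Prop :=
  [/\ {within `[0, 1[ `*` `[0, +oo[,
         continuous (fun xt : R * R => phi xt.1 xt.2)},
      phi 0 0 = 1 &
      positive_definite (half_ball R d `*` [set: 'rV[R]_d'])
        (fun p q => phi (edist p.1 q.1) (edist p.2 q.2))].

Definition P_ball_sphere {R : realType} (d d' : nat) (psi : R -> R -> R)
    : Prop :=
  [/\ {within `[0, 1[ `*` `[0, pi],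
         continuous (fun xt : R * R => psi xt.1 xt.2)},
      psi 0 0 = 1 &
      positive_definite (half_ball R d `*` sphere R d')
        (fun p q => psi (edist p.1 q.1) (geodist p.2 q.2))].

(* Euler's integral; it has its usual meaning for 0 < s. *)
Definition Gamma {R : realType} (s : R) : R :=
  \int[@lebesgue_measure R]_(t in `]0, +oo[) (t `^ (s - 1) * expR (- t)).

Definition alpha_cst (R : realType) (d : nat) : R :=
  Gamma (d%:R / 2) / (Num.sqrt pi * Gamma (d.+1%:R / 2)).

Definition phi_of {R : realType} (d : nat) (alpha : R -> R) (x t : R) : R :=
  (1 + alpha t * (1 / 2 - alpha_cst R d * x)) / (1 + alpha 0 / 2).

(* Main.v *)
From HB Require Import structures.
Require Import Defs.
From mathcomp Require Import all_boot all_order all_algebra.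
From mathcomp Require Import all_classical all_reals all_analysis.
From mathcomp Require Import ring lra measurable_realfun.

(** Since the kernel [alpha] enters linearly, it suffices that the kernel
    [1/2 - alpha_d |x - x'|] on the ball stays positive after entrywise
    multiplication by any positive semidefinite matrix.  On the line,
    [M/2 - |u - u'|] with [|u|, |u'| <= M/2] is an integral of rank-one kernels,
    for which this is clear.  Apply it to [u = <x, X>] and [M = |X|], where [X]
    is a Gaussian vector of [R^d], and take expectations:
    [E |<v, X>| / E |X| = alpha_d |v|], because [<v, X>] is distributed as
    [|v|] times a one-dimensional Gaussian and [|X|] has a density proportional
    to [r^(d-1) e^(-r^2)].  Both distributions are obtained by induction on
    [d], using only Tonelli's theorem and affine changes of variables in one
    dimension. *)

Set Implicit Arguments.
Unset Strict Implicit.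
Unset Printing Implicit Defensive.
Import Order.TTheory GRing.Theory Num.Theory.
Import numFieldNormedType.Exports.
Local Open Scope classical_set_scope.
Local Open Scope ring_scope.

(** * Positivity on the line *)

(** The double sum is the integral of a pointwise nonnegative function. This serves twice: on an
    interval with Lebesgue measure, and on the space carrying the Gaussian vector. *)
Lemma ge0_sum_Rintegral {disp : measure_display} {T : measurableType disp}
    {R : realType} (mu : {measure set T -> \bar R}) (D : set T) (N : nat)
    (B : 'I_N -> 'I_N -> R) (k : 'I_N -> 'I_N -> T -> R) :
  measurable D ->
  (forall i j, mu.-integrable D (EFin \o k i j)) ->
  (forall t, D t -> 0 <= \sum_(i < N) \sum_(j < N) B i j * k i j t) ->
  0 <= \sum_(i < N) \sum_(j < N) B i j * (\int[mu]_(t in D) k i j t).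
Proof.
move=> mD ik kB.
have iBk i j : mu.-integrable D (fun t => (B i j * k i j t)%:E).
  by have := integrableZl mD (B i j) (ik i j).
rewrite -lee_fin.
suff -> : (\sum_(i < N) \sum_(j < N) B i j * (\int[mu]_(t in D) k i j t))%:E =
    (\int[mu]_(t in D) (\sum_(i < N) \sum_(j < N) B i j * k i j t)%:E)%E.
  by apply: integral_ge0 => t Dt; rewrite lee_fin; exact: kB.
under eq_integral do rewrite -sumEFin.
rewrite integral_sum//=; last first.
  by move=> i; under eq_fun do rewrite -sumEFin; exact: integrable_sum.
rewrite -sumEFin; apply: eq_bigr => i _.
under [RHS]eq_integral do rewrite -sumEFin.
rewrite integral_sum//= -sumEFin; apply: eq_bigr => j _.
rewrite -RintegralZl// fineK//; exact: integrable_fin_num.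
Qed.

Lemma Rintegral_ltr_indic {R : realType} (a b u : R) : a <= u <= b ->
  \int[lebesgue_measure]_(t in `[a, b]) (t < u)%R%:R = u - a.
Proof.
move=> /andP[au ub].
transitivity (\int[lebesgue_measure]_(t in `[a, b]) \1_`[a, u[ t : R).
  apply: eq_Rintegral => t; rewrite inE/= in_itv/= => /andP[at_ tb].
  rewrite indicE; congr (_%:R); congr nat_of_bool.
  by apply/idP/idP; rewrite inE/= in_itv/= at_.
rewrite /Rintegral integral_indic//= setIidl.
  rewrite lebesgue_measure_itv/= lte_fin.
  by case: ltgtP au => // -> _; rewrite subrr.
move=> t /=; rewrite !in_itv/= => /andP[-> /ltW tu]; exact: le_trans ub.
Qed.

Lemma integrable_ltr_indic {R : realType} (a b u : R) :
  (@lebesgue_measure R).-integrable `[a, b] (fun t => ((t < u)%R%:R)%:E).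
Proof.
have -> : (fun t => ((t < u)%R%:R)%:E) = EFin \o \1_(`]-oo, u[%classic) :> (R -> \bar R).
  by apply/funext => t /=; rewrite indicE mem_setE in_itv.
apply: measurable_bounded_integrable => //.
- by rewrite /= lebesgue_measure_itv/=; case: ifP => _; rewrite ltry.
- exists 1; split => // x x1 t _ /=.
  by rewrite indicE ger0_norm ?ler0n// (le_trans _ (ltW x1))// lern1 leq_b1.
Qed.

(* Writing s_i(t) = 1/2 - 1_{t < u_i}, one has
   M/2 - |u_i - u_j| = \int_{-M/2}^{M/2} 2 s_i(t) s_j(t) dt. *)
Lemma half_dist_schur {R : realType} (N : nat) (B : 'I_N -> 'I_N -> R)
    (M : R) (u : 'I_N -> R) :
  (forall c : 'I_N -> R, 0 <= \sum_(i < N) \sum_(j < N) c i * c j * B i j) ->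
  (forall i, `|u i| <= M / 2) ->
  0 <= \sum_(i < N) \sum_(j < N) B i j * (M / 2 - `|u i - u j|).
Proof.
move=> B0 uM.
pose s i t : R := 2^-1 - (t < u i)%R%:R.
pose mu := @lebesgue_measure R.
pose D := `[- (M / 2), M / 2]%classic.
have mD : measurable (D : set (measurableTypeR R)) by exact: measurable_itv.
(* Both indicators hold at once exactly when [t < min (u_i, u_j)], so after expansion only integrals
   of single indicators remain. *)
have k_sum i j : (fun t => 2 * (s i t * s j t)) =
    (fun t => (2^-1 - (t < u i)%R%:R) - (t < u j)%R%:R +
              2 * (t < Num.min (u i) (u j))%R%:R).
  apply/funext => t; rewrite /s lt_min.
  by case: (t < u i); case: (t < u j); rewrite /=; field.
have i1 : mu.-integrable D (EFin \o cst 2^-1).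
  apply: measurable_bounded_integrable => //.
  - by rewrite /mu /D/= lebesgue_measure_itv/=; case: ifP => _; rewrite ltry.
  - by exists `|2^-1|; split => // x x1 t _ /=; exact: ltW.
have i2 (v : R) : mu.-integrable D (EFin \o (fun t => (t < v)%R%:R)).
  exact: integrable_ltr_indic.
have i3 (v : R) : mu.-integrable D (EFin \o (fun t => 2 * (t < v)%R%:R)).
  by have := integrableZl mD 2 (i2 v).
have i4 (v : R) : mu.-integrable D (EFin \o (fun t => 2^-1 - (t < v)%R%:R)).
  by have := integrableB mD i1 (i2 v).
have i5 (v w : R) : mu.-integrable D
    (EFin \o (fun t => 2^-1 - (t < v)%R%:R - (t < w)%R%:R)).
  by have := integrableB mD (i4 v) (i2 w).
have ik i j : mu.-integrable D (EFin \o (fun t => 2 * (s i t * s j t))).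
  by rewrite k_sum; have := integrableD mD (i5 (u i) (u j)) (i3 (Num.min (u i) (u j))).
have kE i j : \int[mu]_(t in D) (2 * (s i t * s j t)) = M / 2 - `|u i - u j|.
  rewrite k_sum RintegralD// RintegralB// RintegralB// RintegralZl//.
  have /ler_normlP[ui1 ui2] := uM i; have /ler_normlP[uj1 uj2] := uM j.
  have M0 : - (M / 2) <= M / 2 by lra.
  have mM : - (M / 2) <= Num.min (u i) (u j) <= M / 2.
    by rewrite le_min ge_min; lra.
  rewrite !Rintegral_ltr_indic//; [|lra..].
  rewrite Rintegral_cst// /mu /D/= lebesgue_measure_itv/= lte_fin.
  (* The length of the interval is given by cases; the branch treated first is the degenerate one,
     where [M = 0] and [u i = u j = 0]. *)
  have [lM|] := ltP; last first.
    by move=> ?; have [] := leP (u i) (u j); case: ler0P => /=; lra.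
  by have [] := leP (u i) (u j); case: ler0P => /=; lra.
under eq_bigr do under eq_bigr do rewrite -kE.
apply: ge0_sum_Rintegral => // t _.
(* For fixed [t] the sum is twice the quadratic form of [B] at the vector of the [s i t]. *)
suff -> : \sum_(i < N) \sum_(j < N) B i j * (2 * (s i t * s j t)) =
    2 * \sum_(i < N) \sum_(j < N) s i t * s j t * B i j by rewrite mulr_ge0.
rewrite mulr_sumr; apply: eq_bigr => i _; rewrite mulr_sumr.
by apply: eq_bigr => j _; ring.
Qed.

(** Lagrange's identity writes twice the defect [|u|^2 |v|^2 - <u, v>^2] as a double sum of squares
    of 2-by-2 minors. *)
Lemma inner_CauchySchwarz {R : realType} (n : nat) (u v : 'rV[R]_n) :
  `|inner u v| <= enorm u * enorm v.
Proof.
have sq0 (w : 'rV[R]_n) : 0 <= inner w w.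
  by apply: sumr_ge0 => i _; rewrite -expr2 sqr_ge0.
rewrite -(@ler_pXn2r _ 2) ?nnegrE ?mulr_ge0 ?sqrtr_ge0//.
rewrite exprMn !sqr_sqrtr// real_normK ?num_real// -subr_ge0.
rewrite -(pmulr_rge0 _ (ltr0n R 2)).
have -> : 2 * (inner u u * inner v v - inner u v ^+ 2) =
    \sum_(i < n) \sum_(j < n)
       (u ord0 i * v ord0 j - u ord0 j * v ord0 i) ^+ 2.
  have E (a b : 'I_n -> R) : (\sum_i a i) * (\sum_i b i) =
      \sum_i \sum_j a i * b j.
    by rewrite mulr_suml; apply: eq_bigr => i _; rewrite mulr_sumr.
  rewrite mulrBr mulr2n mulrDl mul1r {2}[inner u u * _]mulrC.
  rewrite expr2 /inner !E mulr_sumr -big_split -sumrB; apply: eq_bigr => i _.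
  rewrite mulr_sumr -big_split -sumrB; apply: eq_bigr => j _ /=.
  by ring.
by apply: sumr_ge0 => i _; apply: sumr_ge0 => j _; exact: sqr_ge0.
Qed.

(** * Gaussian integrals *)

Section affine.
Context {R : realType}.
Local Notation mu := (@lebesgue_measure R).

(** Lebesgue measure is determined by its values on the intervals []x, y]], so the scaled
    pushforward need only be computed there. *)
Lemma lebesgue_measure_affine (c a : R) (A : set R) : 0 < c -> measurable A ->
  (c%:E * pushforward mu ((fun x => c * x + a)%R : R -> measurableTypeR R) A =
   mu A)%E.
Proof.
move=> c0 mA.
have mf : measurable_fun setT ((fun x : R => c * x + a) : _ -> measurableTypeR R).
  by apply: measurable_funD => //; exact: measurable_funM.
apply/esym.
rewrite (_ : (_ * _)%E = mscale (NngNum (ltW c0)) (pushforward mu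
  ((fun x : R => c * x + a) : _ -> measurableTypeR R)) A)//.
apply: lebesgue_measure_unique => // _ [[x y]] _ <-.
rewrite -[RHS]/(c%:E * mu ((fun z : R => c * z + a)%R @^-1` `]x, y]))%E.
have -> : (fun z : R => c * z + a) @^-1` `]x, y] =
    `](x - a) / c, (y - a) / c]%classic.
  apply/seteqP; split => z /=; rewrite !in_itv/=.
    by rewrite ltr_pdivrMr// ler_pdivlMr// ltrBlDr lerBrDr mulrC.
  by rewrite ltr_pdivrMr// ler_pdivlMr// ltrBlDr lerBrDr mulrC.
rewrite !lebesgue_measure_itv/= !lte_fin ltr_pM2r ?invr_gt0// ltrD2r.
case: ifP => _; rewrite ?mule0// -!EFinB -EFinM; congr EFin.
by field; rewrite gt_eqF.
Qed.

(** Nonnegativity replaces integrability: both sides may be [+oo]. *)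
Lemma ge0_integral_affine (c a : R) (f : R -> \bar R) : 0 < c ->
  measurable_fun setT f -> (forall x, 0 <= f x)%E ->
  (\int[mu]_x f (c * x + a)%R = c^-1%:E * \int[mu]_x f x)%E.
Proof.
move=> c0 mf f0.
pose h : measurableTypeR R -> measurableTypeR R := fun x => (c * (x : R) + a)%R.
have mh : measurable_fun setT h.
  by apply: measurable_funD => //; exact: measurable_funM.
have := @ge0_integral_pushforward _ _ _ _ R _ mh mu _ f measurableT mf
  (fun x _ => f0 x).
rewrite preimage_setT => <-.
suff <- : (c%:E * \int[pushforward mu h]_y f y = \int[mu]_y f y)%E.
  by rewrite muleA -EFinM mulVf ?gt_eqF// mul1e.
rewrite -{1}[c]/((NngNum (ltW c0))%:num) -ge0_integral_mscale//.
by apply: eq_measure_integral => A mA _; exact: lebesgue_measure_affine.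
Qed.

Lemma ge0_integral_opp (f : R -> \bar R) :
  measurable_fun setT f -> (forall x, 0 <= f x)%E ->
  (\int[mu]_x f (- (x : R))%R = \int[mu]_x f x)%E.
Proof.
move=> mf f0.
pose h : measurableTypeR R -> measurableTypeR R := -%R.
have mh : measurable_fun setT h by exact: oppr_measurable.
have := @ge0_integral_pushforward _ _ _ _ R _ mh mu _ f measurableT mf
  (fun x _ => f0 x).
rewrite preimage_setT => <- //.
by apply: eq_measure_integral => A mA _; exact: lebesgue_measureN.
Qed.
End affine.

(** * One-dimensional Gaussian integrals and their convolution *)

Section gauss.
Context {R : realType}.
Local Notation mu := (@lebesgue_measure R).

Lemma measurable_gauss : measurable_fun setT (fun x : R => (expR (- x ^+ 2))%:E).
Proof. by apply/measurable_EFinP; exact: measurable_gauss_fun. Qed.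

Lemma measurable_gauss_affine (c a : R) :
  measurable_fun setT (fun x : R => (expR (- (c * x + a) ^+ 2))%:E).
Proof.
apply: (measurableT_comp measurable_gauss).
by apply: measurable_funD => //; exact: measurable_funM.
Qed.

Lemma integral_gauss :
  (\int[mu]_x (expR (- (x : R) ^+ 2))%:E = (Num.sqrt pi)%:E)%E.
Proof. exact: integralT_gauss. Qed.

Lemma integral_gauss_affine (c a : R) : 0 < c ->
  (\int[mu]_x (expR (- (c * (x : R) + a) ^+ 2))%:E = (c^-1 * Num.sqrt pi)%:E)%E.
Proof.
move=> c0.
by rewrite (ge0_integral_affine a c0 measurable_gauss)// EFinM -integral_gauss.
Qed.

(** The Gaussian weight is even, so [t -> - t] removes the sign of [a]. *)
Lemma ge0_integral_gauss_norm (a : R) (f : R -> \bar R) :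
  measurable_fun setT f -> (forall x, 0 <= f x)%E ->
  (\int[mu]_t (f (a * (t : R))%R * (expR (- (t : R) ^+ 2))%:E) =
   \int[mu]_t (f (`|a| * (t : R))%R * (expR (- (t : R) ^+ 2))%:E))%E.
Proof.
move=> mf f0; have [//|a0] := ger0P a.
rewrite -[LHS]ge0_integral_opp.
- by under eq_integral do rewrite mulrN -mulNr sqrrN.
- apply: emeasurable_funM; last exact: measurable_gauss.
  by apply: measurableT_comp => //; exact: measurable_funM.
- by move=> t; exact: mule_ge0.
Qed.

(* Substitute w = a t + b u in the inner integral, exchange the integrals, and
   complete the square in t. *)
Lemma ge0_integral_gauss_conv (a b : R) (f : R -> \bar R) : 0 <= b ->
  measurable_fun setT f -> (forall x, 0 <= f x)%E ->
  (\int[mu]_t ((expR (- (t : R) ^+ 2))%:E *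
     \int[mu]_u (f (a * (t : R) + b * (u : R))%R * (expR (- (u : R) ^+ 2))%:E)) =
   (Num.sqrt pi)%:E *
     \int[mu]_w (f (Num.sqrt (a ^+ 2 + b ^+ 2) * (w : R))%R * (expR (- (w : R) ^+ 2))%:E))%E.
Proof.
(* The substitution divides by [b]. When [b = 0] the inner integral is just [f (a * t)] times the
   Gaussian mass [Num.sqrt pi]. *)
rewrite le_eqVlt => /predU1P[<-|b0] mf f0.
  have mfc (c : R) : measurable_fun setT (fun t : R => f (c * t)).
    by apply: measurableT_comp => //; exact: measurable_funM.
  have mfg (c : R) : measurable_fun setT (fun t : R => f (c * t)%R * (expR (- t ^+ 2))%:E)%E.
    by apply: emeasurable_funM => //; exact: measurable_gauss.
  transitivity ((Num.sqrt pi)%:E *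
      \int[mu]_t (f (a * (t : R))%R * (expR (- (t : R) ^+ 2))%:E))%E.
    rewrite -ge0_integralZl//; [|exact: mfg|by move=> t _; exact: mule_ge0].
    apply: eq_integral => t _; under eq_integral do rewrite mul0r addr0.
    rewrite ge0_integralZl//; last exact: measurable_gauss.
    by rewrite integral_gauss muleA [LHS]muleC (muleC (expR _)%:E).
  by rewrite expr0n addr0 sqrtr_sqr -ge0_integral_gauss_norm.
set r := Num.sqrt (a ^+ 2 + b ^+ 2).
have r2 : r ^+ 2 = a ^+ 2 + b ^+ 2.
by rewrite sqr_sqrtr// addr_ge0 ?sqr_ge0.
have r0 : 0 < r by rewrite sqrtr_gt0 ltr_wpDl ?sqr_ge0// exprn_gt0.
have rn0 := gt_eqF r0; have bn0 := gt_eqF b0.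
(* The weight in the variables [t] and [w], with [u = (w - a t) / b]. Completing the square gives
   [t^2 + (w - a t)^2 / b^2 = w^2 / r^2 + (r t / b - a w / (r b))^2]. *)
pose E (t w : R) := expR (- t ^+ 2) * expR (- (b^-1 * w + - a * t / b) ^+ 2).
have EE t w : E t w = expR (- (r^-1 * w + 0) ^+ 2) *
    expR (- (r / b * t + - a * w / (r * b)) ^+ 2).
  rewrite /E -!expRD; congr expR.
  (* Both exponents are multiplied by [r ^+ 2], so that [r2] can eliminate the square root. *)
  apply: (mulIf (negbT (_ : (r ^+ 2 == 0) = false))); first by rewrite sqrf_eq0.
  transitivity (- t ^+ 2 * r ^+ 2 - ((w - a * t) / b) ^+ 2 * r ^+ 2).
    by field; rewrite bn0.
  transitivity (- w ^+ 2 - ((r ^+ 2 * t - a * w) / b) ^+ 2); last first.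
    by field; rewrite bn0 rn0.
  by rewrite r2; field; rewrite bn0.
have mE : measurable_fun setT (fun z : R * R => (f z.2 * (E z.1 z.2)%:E)%E).
  apply: emeasurable_funM; first exact: measurableT_comp.
  apply/measurable_EFinP/measurable_funM; apply: measurableT_comp => //.
    by apply: measurableT_comp => //; apply: measurable_funX.
  apply: measurableT_comp => //; apply: measurable_funX.
  by apply: measurable_funD; [exact: measurable_funM|];
    apply: measurable_funM => //; exact: measurable_funM.
have E0 t w : 0 <= E t w by rewrite mulr_ge0 ?expR_ge0.
have E1 (c : R) : measurable_fun setT
    (fun w : R => (f w * (expR (- (b^-1 * w + c) ^+ 2))%:E)%E).
  by apply: emeasurable_funM => //; exact: measurable_gauss_affine.
transitivity (\int[mu]_t (b^-1%:E * \int[mu]_w (f w * (E t w)%:E)))%E.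
  apply: eq_integral => t _.
  have H0 c x : (0 <= f x * (expR (- (b^-1 * x + c) ^+ 2))%:E)%E.
    by rewrite mule_ge0// lee_fin expR_ge0.
  rewrite (_ : \int[mu]_u _ = b^-1%:E * \int[mu]_w (f w *
      (expR (- (b^-1 * (w : R) + - a * (t : R) / b) ^+ 2))%:E))%E; last first.
    rewrite -(ge0_integral_affine (a * t) b0 (E1 _) (H0 _)).
    apply: eq_integral => u _; rewrite addrC.
    by congr (_ * (expR (- _ ^+ 2))%:E)%E; field; rewrite bn0.
  rewrite muleCA -ge0_integralZl//; [|exact: E1].
  by congr (_ * _)%E; apply: eq_integral => w _; rewrite muleCA -EFinM.
have fE0 z : (0 <= f z.2 * (E z.1 z.2)%:E)%E by rewrite mule_ge0// lee_fin.
rewrite ge0_integralZl//; last 3 first.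
- exact: (measurable_fun_fubini_tonelli_F (m2 := lebesgue_measure) _ mE fE0).
- by move=> t _; apply: integral_ge0 => w _; exact: (fE0 (t, w)).
- by rewrite lee_fin invr_ge0 ltW.
rewrite (fubini_tonelli (m1 := mu) (m2 := mu) _ mE fE0).
(* Integrating out [t] yields a factor [b / r]. With the Jacobian [b^-1] it leaves [r^-1], which the
   final substitution of [r w] for [w] absorbs. *)
have inner w : (\int[mu]_t (f w * (E t w)%:E) =
   f w * (expR (- (r^-1 * w + 0) ^+ 2))%:E * (b / r * Num.sqrt pi)%:E)%E.
  under eq_integral do rewrite EE EFinM muleA.
  rewrite ge0_integralZl//; last 2 first.
  - exact: measurable_gauss_affine.
  - by rewrite mule_ge0// lee_fin expR_ge0.
  by rewrite integral_gauss_affine ?divr_gt0// invf_div.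
under eq_integral do rewrite inner.
have mr : measurable_fun setT
    (fun w : R => (f w * (expR (- (r^-1 * w + 0) ^+ 2))%:E)%E).
  by apply: emeasurable_funM => //; exact: measurable_gauss_affine.
have r_ge0 w : (0 <= f w * (expR (- (r^-1 * w + 0) ^+ 2))%:E)%E.
  by rewrite mule_ge0// lee_fin expR_ge0.
rewrite ge0_integralZr//; last by rewrite lee_fin mulr_ge0 ?divr_ge0 ?sqrtr_ge0 ?(ltW b0) ?(ltW r0).
rewrite muleCA -EFinM muleC.
rewrite (_ : b^-1 * _ = Num.sqrt pi * r^-1); last by field; rewrite bn0 rn0.
rewrite EFinM -muleA; congr (_ * _)%E.
rewrite -(ge0_integral_affine 0 r0 mr r_ge0).
apply: eq_integral => w _; rewrite !addr0.
by rewrite mulrA mulVf ?rn0// mul1r.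
Qed.
End gauss.

(** * Polar integration in the plane *)

Section radial.
Context {R : realType}.
Local Notation mu := (@lebesgue_measure R).

Lemma measurable_sqrt : measurable_fun setT (@Num.sqrt R).
Proof. by apply: continuous_measurable_fun => x; exact: sqrt_continuous. Qed.

Lemma measurable_sqrtD_sqr : measurable_fun setT (fun z : R * R => Num.sqrt (z.1 ^+ 2 + z.2 ^+ 2)).
Proof.
apply: measurableT_comp; first exact: measurable_sqrt.
by apply: measurable_funD; exact: measurable_funX.
Qed.

Lemma measurable_normX (n : nat) : measurable_fun setT (fun x : R => `|x| ^+ n).
Proof. by apply: measurable_funX; exact: normr_measurable. Qed.

(** This is the Beta integral [B((n + 1) / 2, 1 / 2)]. It stays unevaluated in [\bar R], since only
    its sign is used. *)
Definition radial_cst (n : nat) : \bar R :=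
  (\int[mu]_s ((`|s : R| ^+ n) * (Num.sqrt (1 + (s : R) ^+ 2))^-1 ^+ n.+2)%:E)%E.

Lemma radial_cst_ge0 n : (0 <= radial_cst n)%E.
Proof.
by apply: integral_ge0 => s _; rewrite lee_fin mulr_ge0 ?exprn_ge0 ?invr_ge0 ?sqrtr_ge0.
Qed.

(* Substitute r = |t| s, exchange the integrals, and rescale t by
   sqrt (1 + s^2). *)
Lemma ge0_integral_polar (n : nat) (f : R -> \bar R) :
  measurable_fun setT f -> (forall x, 0 <= f x)%E ->
  (\int[mu]_t \int[mu]_r
      (f (Num.sqrt ((t : R) ^+ 2 + (r : R) ^+ 2)) * (`|r : R| ^+ n)%:E) =
   radial_cst n * \int[mu]_x (f `|x : R|%R * (`|x : R| ^+ n.+1)%:E))%E.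
Proof.
move=> mf f0.
pose F (z : R * R) := (f (Num.sqrt (z.1 ^+ 2 + z.2 ^+ 2)) * (`|z.2| ^+ n)%:E)%E.
have F0 z : (0 <= F z)%E by rewrite mule_ge0// lee_fin.
have mF : measurable_fun setT F.
  apply: emeasurable_funM; first by apply: measurableT_comp; last exact: measurable_sqrtD_sqr.
  by apply/measurable_EFinP/(measurableT_comp (measurable_normX n)).
pose p (s : R) := Num.sqrt (1 + s ^+ 2).
have p0 s : 0 < p s by rewrite sqrtr_gt0 ltr_pwDl// sqr_ge0.
have mp : measurable_fun setT p.
  apply: measurableT_comp; first exact: measurable_sqrt.
  by apply: measurable_funD => //; exact: measurable_funX.
(* With [r = |t| s] one has [sqrt (t^2 + r^2) = |t| p(s)], and the Jacobian [|t|] raises the power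
   of [|t|] from [n] to [n.+1]. *)
pose G (z : R * R) := (f (`|z.1| * p z.2)%R * (`|z.1| ^+ n.+1 * `|z.2| ^+ n)%:E)%E.
have G0 z : (0 <= G z)%E by rewrite mule_ge0// lee_fin mulr_ge0.
have mG : measurable_fun setT G.
  apply: emeasurable_funM.
    apply: measurableT_comp => //; apply: measurable_funM; last exact: measurableT_comp.
    exact: measurableT_comp.
  apply/measurable_EFinP/measurable_funM.
    exact: (measurableT_comp (measurable_normX n.+1)).
  exact: (measurableT_comp (measurable_normX n)).
transitivity (\int[mu]_t \int[mu]_s G (t, s))%E.
  (* The substitution degenerates at [t = 0], so the inner integrals are compared only off the null
     set [{0}]. *)
  apply: ge0_ae_eq_integral => //.
  - exact: (measurable_fun_fubini_tonelli_F (m2 := lebesgue_measure) _ mF F0).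
  - exact: (measurable_fun_fubini_tonelli_F (m2 := lebesgue_measure) _ mG G0).
  - by move=> t _; apply: integral_ge0 => r _; exact: (F0 (t, r)).
  - by move=> t _; apply: integral_ge0 => r _; exact: (G0 (t, r)).
  exists [set 0]; split; [exact: measurable_set1|exact: lebesgue_measure_set1|].
  move=> t /= /not_implyP[_ tFG]; apply: contrapT => /eqP t0; apply: tFG.
  have nt0 : 0 < `|t| by rewrite normr_gt0.
  have mFt : measurable_fun setT (fun r => F (t, r)).
    by apply: measurableT_comp => //; exact: measurable_pair1.
  have := ge0_integral_affine 0 nt0 mFt (fun r => F0 (t, r)).
  move=> /(congr1 (fun z => `|t|%:E * z)%E).
  rewrite muleA -EFinM divff ?gt_eqF// mul1e => <-.
  rewrite -ge0_integralZl//; last first.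
    apply: (measurableT_comp mFt) => //.
    by apply: measurable_funD => //; exact: measurable_funM.
  apply: eq_integral => s _; rewrite /F /G/= addr0.
  rewrite muleCA -EFinM; congr (f _ * _%:E)%E.
    rewrite exprMn real_normK ?num_real// -[X in X + _]mulr1 -mulrDr.
    by rewrite sqrtrM ?sqr_ge0// sqrtr_sqr.
  by rewrite normrM normr_id exprMn mulrA -exprS.
rewrite (fubini_tonelli (m1 := mu) (m2 := mu) _ mG G0).
have mI : measurable_fun setT (fun x : R => (f `|x|%R * (`|x| ^+ n.+1)%:E)%E).
  apply: emeasurable_funM; first exact: measurableT_comp.
  by apply/measurable_EFinP; exact: measurable_normX.
have I0 (x : R) : (0 <= f `|x|%R * (`|x| ^+ n.+1)%:E)%E by rewrite mule_ge0.
(* Of the [n.+2] factors [(p s)^-1], one is the Jacobian of the rescaling and the others come from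
   [|t| ^+ n.+1]. *)
have inner (s : R) : (\int[mu]_t G (t, s) = (`|s| ^+ n * (p s)^-1 ^+ n.+2)%:E *
    \int[mu]_x (f `|x : R|%R * (`|x : R| ^+ n.+1)%:E))%E.
  rewrite exprSr mulrA EFinM -muleA -(ge0_integral_affine 0 (p0 s) mI I0).
  rewrite -ge0_integralZl//; last 2 first.
  - apply: (measurableT_comp mI).
    by apply: measurable_funD => //; exact: measurable_funM.
  - by rewrite lee_fin mulr_ge0 ?exprn_ge0 ?invr_ge0 ?(ltW (p0 s)).
  apply: eq_integral => t _; rewrite /G/= addr0 normrM (ger0_norm (ltW (p0 s))).
  rewrite muleCA -EFinM; congr (f _ * _%:E)%E; first by rewrite mulrC.
  by rewrite -mulrA -exprMn mulrA mulVf ?gt_eqF// mul1r mulrC.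
under eq_integral do rewrite inner.
rewrite ge0_integralZr//.
- apply/measurable_EFinP/measurable_funM; first exact: measurable_normX.
  apply: measurable_funX; apply: continuous_measurable_fun => s.
  apply: cvgV; first by rewrite gt_eqF// p0.
  apply: continuous_comp; last exact: sqrt_continuous.
  by apply: cvgD; [exact: cvg_cst|exact: exprn_continuous].
- by move=> s _; rewrite lee_fin mulr_ge0 ?exprn_ge0 ?invr_ge0 ?(ltW (p0 s)).
- by apply: integral_ge0 => x _; exact: I0.
Qed.
End radial.

(** * Gaussian vectors *)

(* Structure inference finds [m1 \x m2] sigma-finite only for
   subprobabilities. *)
Lemma product_measure_sigma_finite {d1 d2 : measure_display}
    {T1 : measurableType d1} {T2 : measurableType d2} {R : realType}
    (m1 : {sigma_finite_measure set T1 -> \bar R})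
    (m2 : {sigma_finite_measure set T2 -> \bar R}) :
  sigma_finite setT (m1 \x m2)%E.
Proof.
have /sigma_finiteP[F [TF ndF Foo]] := sigma_finiteT m1.
have /sigma_finiteP[G [TG ndG Goo]] := sigma_finiteT m2.
exists (fun n => F n `*` G n) => [|n].
  apply/seteqP; split=> // -[x y] _.
  have [i _ Fx] : (\bigcup_i F i) x by rewrite -TF.
  have [j _ Gy] : (\bigcup_i G i) y by rewrite -TG.
  exists (maxn i j) => //; split.
    by move: x Fx; exact/subsetPset/ndF/leq_maxl.
  by move: y Gy; exact/subsetPset/ndG/leq_maxr.
have [mF Fn] := Foo n; have [mG Gn] := Goo n.
split; first exact: measurableX.
by rewrite product_measure1E// lte_mul_pinfty// ge0_fin_numE.
Qed.

Section gauss_space.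
Context {R : realType}.
Local Notation mu := (@lebesgue_measure R).

(* A space carrying the coordinates of the vector is all that is needed, so no
   measure on row vectors is built; the Gaussian density is kept in the
   integrand and [P] is in fact a product of Lebesgue measures. *)
Lemma gauss_space (n : nat) :
  exists (disp : measure_display) (T : measurableType disp)
    (P : {sigma_finite_measure set T -> \bar R}) (X : 'I_n.+1 -> T -> R),
  [/\ forall i, measurable_fun setT (X i),
      forall (v : 'I_n.+1 -> R) (f : R -> \bar R),
        measurable_fun setT f -> (forall x, 0 <= f x)%E ->
        (\int[P]_w (f (\sum_(i < n.+1) v i * X i w)%R *
                    (expR (- \sum_(i < n.+1) X i w ^+ 2))%:E) =
         (Num.sqrt pi ^+ n)%:E *
         \int[mu]_t (f (Num.sqrt (\sum_(i < n.+1) v i ^+ 2) * (t : R))%R *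
                     (expR (- (t : R) ^+ 2))%:E))%E
    & exists2 C : \bar R, (0 <= C)%E &
        forall f : R -> \bar R,
        measurable_fun setT f -> (forall x, 0 <= f x)%E ->
        (\int[P]_w f (Num.sqrt (\sum_(i < n.+1) X i w ^+ 2)) =
         C * \int[mu]_r (f `|r : R|%R * (`|r : R| ^+ n)%:E))%E].
Proof.
elim: n => [|n [disp [T [P [X [mX XA [C C0 XC]]]]]]].
  exists _, (measurableTypeR R), (@lebesgue_measure R), (fun _ t => t); split.
  - by move=> _; exact: measurable_id.
  - move=> v f mf f0; under eq_integral do rewrite !big_ord1.
    rewrite expr0 mul1e big_ord1.
    by rewrite sqrtr_sqr -ge0_integral_gauss_norm.
  - exists 1%E => // f mf f0; rewrite mul1e; apply: eq_integral => t _.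
    by rewrite big_ord1 sqrtr_sqr expr0 mule1.
(* Induction step: a new coordinate, of index [ord0], is adjoined by taking the product with the
   line. *)
pose X' (i : 'I_n.+2) (z : measurableTypeR R * T) : R :=
  if unlift ord0 i is Some j then X j z.2 else z.1.
have X'0 z : X' ord0 z = z.1 by rewrite /X' unlift_none.
have X'S j z : X' (lift ord0 j) z = X j z.2 by rewrite /X' liftK.
have X'lin (v : 'I_n.+2 -> R) z : \sum_(i < n.+2) v i * X' i z =
    v ord0 * z.1 + \sum_(i < n.+1) v (lift ord0 i) * X i z.2.
  by rewrite big_ord_recl X'0; congr (_ + _); apply: eq_bigr => i _; rewrite X'S.
have X'sqr z : \sum_(i < n.+2) X' i z ^+ 2 = z.1 ^+ 2 + \sum_(i < n.+1) X i z.2 ^+ 2.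
  by rewrite big_ord_recl X'0; congr (_ + _); apply: eq_bigr => i _; rewrite X'S.
have mX' i : measurable_fun setT (X' i).
  rewrite /X'; case: unliftP => [j|] _; last exact: measurable_fst.
  exact: measurableT_comp.
have mlin (v : 'I_n.+2 -> R) : measurable_fun setT (fun z => \sum_i v i * X' i z).
  by apply: measurable_sum => i; exact: measurable_funM.
have msqr : measurable_fun setT (fun z => \sum_i X' i z ^+ 2).
  by apply: measurable_sum => i; exact: measurable_funX.
pose m : {sigma_finite_measure set (measurableTypeR R) -> \bar R} := lebesgue_measure.
pose P' : {sigma_finite_measure set (measurableTypeR R * T)%type -> \bar R} :=
  HB.pack (m \x P)%E
    (Measure_isSigmaFinite.Build _ _ _ _ (product_measure_sigma_finite m P)).
exists _, (measurableTypeR R * T)%type, P', X'; split => //.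
(* Linear forms: for fixed first coordinate [t], [XA] is applied to [u -> f (v_0 t + u)], and
   [ge0_integral_gauss_conv] merges the two Gaussians. *)
- move=> v f mf f0.
  rewrite fubini_tonelli1; last 2 first.
  + apply: emeasurable_funM; first exact: measurableT_comp.
    apply/measurable_EFinP/measurableT_comp => //; exact: measurableT_comp.
  + by move=> z; rewrite mule_ge0.
  set r := Num.sqrt (\sum_(i < n.+1) v (lift ord0 i) ^+ 2).
  have -> : \sum_(i < n.+2) v i ^+ 2 = v ord0 ^+ 2 + r ^+ 2.
    rewrite big_ord_recl sqr_sqrtr// sumr_ge0// => i _; exact: sqr_ge0.
  rewrite exprSr EFinM -muleA -(ge0_integral_gauss_conv (v ord0) (sqrtr_ge0 _) mf f0).
  pose g (z : R * R) := (f (v ord0 * z.1 + r * z.2)%R * (expR (- z.2 ^+ 2))%:E)%E.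
  have g0 z : (0 <= g z)%E by rewrite mule_ge0.
  have mg : measurable_fun setT g.
    apply: emeasurable_funM.
      apply: measurableT_comp => //.
      by apply: measurable_funD; exact: measurable_funM.
    exact: (measurableT_comp measurable_gauss).
  rewrite -ge0_integralZl//; last 2 first.
  + apply: emeasurable_funM; first exact: measurable_gauss.
    exact: (measurable_fun_fubini_tonelli_F (m2 := lebesgue_measure) _ mg g0).
  + move=> t _; rewrite mule_ge0//; apply: integral_ge0 => u _.
    exact: (g0 (t, u)).
  apply: eq_integral => t _; rewrite /fubini_F.
  have mft : measurable_fun setT (fun u : R => f (v ord0 * t + u)).
    by apply: measurableT_comp => //; exact: measurable_funD.
  have := XA (fun i => v (lift ord0 i)) _ mft (fun u => f0 _).
  rewrite -/r muleCA => <-; rewrite -ge0_integralZl//; last 2 first.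
  + apply: emeasurable_funM.
      apply: (measurableT_comp mft); apply: measurable_sum => i.
      exact: measurable_funM.
    apply/measurable_EFinP; apply: measurableT_comp => //.
    apply: measurableT_comp => //.
    by apply: measurable_sum => i; exact: measurable_funX.
  + by move=> w _; rewrite mule_ge0.
  apply: eq_integral => w _.
  rewrite X'lin X'sqr/= opprD expRD EFinM -/r.
  by rewrite muleCA.
(* Norm: for fixed [t], [XC] is applied to [u -> f (sqrt (t^2 + u^2))], and polar integration raises
   the exponent by one. *)
- exists (C * radial_cst n)%E; first by rewrite mule_ge0// radial_cst_ge0.
  move=> f mf f0; rewrite fubini_tonelli1//; last first.
    apply: measurableT_comp => //; apply: measurableT_comp => //.
    exact: measurable_sqrt.
  pose g (z : R * R) := (f (Num.sqrt (z.1 ^+ 2 + z.2 ^+ 2)) * (`|z.2| ^+ n)%:E)%E.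
  have g0 z : (0 <= g z)%E by rewrite mule_ge0// lee_fin.
  have mfs : measurable_fun setT (fun z : R * R => f (Num.sqrt (z.1 ^+ 2 + z.2 ^+ 2))).
    by apply: measurableT_comp; last exact: measurable_sqrtD_sqr.
  have mg : measurable_fun setT g.
    apply: emeasurable_funM => //.
    by apply/measurable_EFinP/(measurableT_comp (measurable_normX n)).
  rewrite -muleA -ge0_integral_polar// -ge0_integralZl//; last 2 first.
  + exact: (measurable_fun_fubini_tonelli_F (m2 := lebesgue_measure) _ mg g0).
  + by move=> t _; apply: integral_ge0 => u _; exact: (g0 (t, u)).
  apply: eq_integral => t _; rewrite /fubini_F.
  have mft : measurable_fun setT (fun u : R => f (Num.sqrt (t ^+ 2 + u ^+ 2))).
    exact: (measurableT_comp mfs (measurable_pair1 t)).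
  transitivity (\int[P]_w f (Num.sqrt (t ^+ 2 +
      Num.sqrt (\sum_(i < n.+1) X i w ^+ 2) ^+ 2)))%E.
    apply: eq_integral => w _; rewrite X'sqr sqr_sqrtr//.
    by apply: sumr_ge0 => i _; exact: sqr_ge0.
  rewrite (XC _ mft (fun u => f0 _)); congr (_ * _)%E.
  by apply: eq_integral => u _; rewrite real_normK ?num_real.
Qed.
End gauss_space.

(** * Gamma function at half-integers *)

Section gamma.
Context {R : realType}.
Local Notation mu := (@lebesgue_measure R).

(** Compact intervals increasing to the open half-line, with the exponent chosen so that squaring
    carries [exhaust 0 i] onto [exhaust 1 i]. *)
Definition exhaust (k : nat) (i : nat) : set R :=
  `[(i.+1%:R^-1) ^+ k.+1, i.+1%:R ^+ k.+1]%classic.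

Lemma exhaust_homo k : {homo exhaust k : n m / (n <= m)%N >-> (n <= m)%O}.
Proof.
move=> i j ij; apply/subsetPset => x; rewrite /exhaust/= !in_itv/= => /andP[ix xi].
apply/andP; split.
  apply: le_trans ix; rewrite lerXn2r ?nnegrE ?invr_ge0//.
  by rewrite lef_pV2 ?posrE// ler_nat.
by apply: (le_trans xi); rewrite lerXn2r ?nnegrE// ler_nat.
Qed.

Lemma bigcup_exhaust k : \bigcup_i exhaust k i = `]0, +oo[%classic.
Proof.
apply/seteqP; split => [x [i _]|x /=].
  rewrite /exhaust/= !in_itv/= andbT => /andP[+ _]; apply: lt_le_trans.
  by rewrite exprn_gt0// invr_gt0.
rewrite in_itv/= andbT => x0.
(* A bound for [x + x^-1] dominates both [x] and [x^-1], hence serves both endpoints. *)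
pose i := Num.bound (x + x^-1).
have xi : x + x^-1 < i.+1%:R.
  apply: (lt_le_trans (archi_boundP _)); first by rewrite addr_ge0// ?invr_ge0 ltW.
  by rewrite ler_nat.
have i1 : 1 <= i.+1%:R :> R by rewrite ler1n.
exists i => //=; rewrite /exhaust/= in_itv/=; apply/andP; split.
  apply: (@le_trans _ _ i.+1%:R^-1).
    by rewrite exprS ler_piMr ?invr_ge0// exprn_ile1 ?invr_ge0// invf_le1.
  rewrite -[leRHS]invrK lef_pV2 ?posrE ?invr_gt0//.
  by apply/ltW/(lt_trans _ xi); rewrite ltrDr.
apply: (@le_trans _ _ i.+1%:R).
  by apply/ltW/(lt_trans _ xi); rewrite ltrDl invr_gt0.
by rewrite exprS ler_peMr// exprn_ege1.
Qed.

(** Monotone convergence along the exhaustion. *)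
Lemma ge0_integral_exhaust_cvg k (f : R -> \bar R) :
  measurable_fun setT f -> (forall x, 0 <= f x)%E ->
  (\int[mu]_(x in exhaust k i) f x @[i --> \oo] -->
   \int[mu]_(x in `]0%R, +oo[) f x)%E.
Proof.
move=> mf f0; rewrite -(bigcup_exhaust k).
apply: ge0_nondecreasing_set_cvg_integral => //.
- exact: exhaust_homo.
- by move=> i; exact: measurable_itv.
- by move=> i; exact: measurable_funTS.
Qed.

Definition gamma_fun (s t : R) := t `^ (s - 1) * expR (- t).

Lemma measurable_gamma_fun s : measurable_fun setT (gamma_fun s).
Proof.
apply: measurable_funM; first exact: measurable_powR.
by apply: measurableT_comp.
Qed.

(** The Gamma integrand pulled back along [t = x^2], with [dt = 2 x dx]; the powers of [x] add up to
    [2 ((n + 1) / 2 - 1) + 1 = n]. *)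
Lemma gamma_fun_sqr (n : nat) (x : R) : 0 < x ->
  gamma_fun (n.+1%:R / 2) (x ^+ 2) * (2 * x) = 2 * (`|x| ^+ n * expR (- x ^+ 2)).
Proof.
move=> x0; rewrite /gamma_fun.
suff -> : `|x| ^+ n = (x ^+ 2) `^ (n.+1%:R / 2 - 1) * x by ring.
rewrite -powR_mulrn ?(ltW x0)// -powRrM -{3}(powRr1 (ltW x0)).
rewrite -powRD; last by rewrite (gt_eqF x0) implybT.
rewrite (ger0_norm (ltW x0)) -powR_mulrn ?(ltW x0)//.
by congr (_ `^ _); rewrite -natr1; field.
Qed.

(** Substitution of [t = x^2] on an interval away from 0, where the Gamma integrand is singular for
    [n = 0]. *)
Lemma integral_gamma_exhaust (n i : nat) :
  (\int[mu]_(t in exhaust 1 i) (gamma_fun (n.+1%:R / 2) t)%:E =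
   \int[mu]_(x in exhaust 0 i) (2 * (`|x : R| ^+ n * expR (- (x : R) ^+ 2)))%:E)%E.
Proof.
rewrite /exhaust !expr1.
set a := _^-1; set b := _%:R.
have a0 : 0 < a by rewrite invr_gt0.
have ab : a <= b by rewrite (@le_trans _ _ 1) ?invf_le1 ?ler1n.
have Fd (x : R) : is_derive x 1 (fun y : R => y ^+ 2) (2 * x).
  by apply: is_derive_eq; rewrite -[x%:A]/(x * 1) mulr1; ring.
have F'E : derive1 (fun y : R => y ^+ 2) = fun x => 2 * x.
  by apply/funext => x; rewrite derive1E; exact: derive_val.
have cF' : continuous (fun x : R => 2 * x).
  by move=> x; apply: cvgM; [exact: cvg_cst|exact: cvg_id].
have cF : continuous (fun x : R => x ^+ 2) by exact: exprn_continuous.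
rewrite (@integration_by_substitution_increasing R (fun x => x ^+ 2)
  (gamma_fun (n.+1%:R / 2)) a b ab).
- apply: eq_integral => x; rewrite inE/= in_itv/= => /andP[ax _].
  by rewrite F'E/= fctE/= gamma_fun_sqr// (lt_le_trans a0).
- move=> x y; rewrite !in_itv/= => /andP[ax _] /andP[ay _] xy.
  by rewrite ltrXn2r// ?nnegrE (le_trans (ltW a0)).
- by rewrite F'E => x _; exact: cF'.
- by rewrite F'E; apply/cvg_ex; exists (2 * a); apply: cvg_at_right_filter; exact: cF'.
- by rewrite F'E; apply/cvg_ex; exists (2 * b); apply: cvg_at_left_filter; exact: cF'.
- split.
  + by move=> x _; exact: ex_derive.
  + by apply: cvg_at_right_filter; exact: cF.
  + by apply: cvg_at_left_filter; exact: cF.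
- apply: continuous_in_subspaceT => x; rewrite inE/= in_itv/= => /andP[ax _].
  have x0 : 0 < x by rewrite (lt_le_trans _ ax) ?exprn_gt0.
  apply: cvgM.
  + suff : {for x, continuous (fun t : R => t `^ (n.+1%:R / 2 - 1))} by [].
    apply/differentiable_continuous/derivable1_diffP.
    by apply: derivable_powR; rewrite in_itv/= x0.
  + by apply: continuous_comp; [exact: continuousN|exact: continuous_expR].
Qed.

(** By evenness the left side is twice a half-line integral. The substituted integrals agree on each
    exhausting interval, hence so do their limits. *)
Lemma integral_normX_gauss (n : nat) :
  (\int[mu]_x (`|x : R| ^+ n * expR (- (x : R) ^+ 2))%:E =
   \int[mu]_(t in `]0%R, +oo[) (gamma_fun (n.+1%:R / 2) t)%:E)%E.
Proof.
have cg : continuous (fun x : R => `|x| ^+ n * expR (- x ^+ 2)).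
  have cn : continuous (fun x : R => `|x| ^+ n).
    move=> x; apply: (@continuous_comp _ _ _ (fun x : R => `|x|) (fun x => x ^+ n)).
      exact: norm_continuous.
    exact: exprn_continuous.
  by move=> x; apply: cvgM; [exact: cn|exact: continuous_gauss_fun].
have mg := continuous_measurable_fun cg.
have g0 (x : R) : 0 <= `|x| ^+ n * expR (- x ^+ 2) by rewrite mulr_ge0 ?exprn_ge0 ?expR_ge0.
rewrite (ge0_symfun_integralT g0 cg); last by move=> x /=; rewrite normrN sqrrN.
rewrite -set_itvcy -integral_itv_obnd_cbnd; last exact/measurable_EFinP/measurable_funTS.
have mG : measurable_fun setT (fun t : R => (gamma_fun (n.+1%:R / 2) t)%:E).
  by apply/measurable_EFinP; exact: measurable_gamma_fun.
have m2g : measurable_fun setT (fun x : R => (2 * (`|x| ^+ n * expR (- x ^+ 2)))%:E).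
  by apply/measurable_EFinP; exact: measurable_funM.
have G0 (t : R) : (0 <= (gamma_fun (n.+1%:R / 2) t)%:E)%E.
  by rewrite lee_fin mulr_ge0 ?powR_ge0 ?expR_ge0.
have g20 (x : R) : (0 <= (2 * (`|x| ^+ n * expR (- x ^+ 2)))%:E)%E by rewrite lee_fin mulr_ge0.
rewrite -ge0_integralZl//; last first.
  by apply/measurable_EFinP/measurable_funTS.
have c1 := ge0_integral_exhaust_cvg 1 mG G0.
have c0 := ge0_integral_exhaust_cvg 0 m2g g20.
apply/esym; apply: (cvg_unique _ c1) => //.
rewrite (_ : (fun _ => _) = (fun i => \int[mu]_(x in exhaust 0 i)
    (2 * (`|x : R| ^+ n * expR (- (x : R) ^+ 2)))%:E)%E)//.
by apply/funext => i; rewrite integral_gamma_exhaust.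
Qed.

(** The total mass of the exponential law of rate 1. *)
Lemma Gamma1 : Gamma (1 : R) = 1.
Proof.
rewrite /Gamma /Rintegral -[RHS]/(fine 1%:E); congr fine.
rewrite -(integral_exponential_pdf (ltr01 : 0 < 1 :> R)).
rewrite (_ : (fun x : R => (exponential_pdf 1 x)%:E) =
  (fun t : R => (expR (- t))%:E) \_ `[0%R, +oo[); last first.
  apply/funext => t; rewrite /exponential_pdf !patchE.
  by case: ifP => // _; rewrite mul1r mulN1r.
rewrite -integral_mkcond -integral_itv_obnd_cbnd; last first.
  by apply/measurable_EFinP/measurable_funTS; apply: measurableT_comp.
by apply: eq_integral => t _; rewrite subrr powRr0 mul1r.
Qed.

(** Integrating [exp (- |X|^2)] by both formulas of [gauss_space] gives
    [C * I = Num.sqrt pi ^+ n.+1]. As this is positive and finite, [I] can be neither 0 nor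
    [+oo]. *)
Lemma integral_normX_gauss_pos (n : nat) :
  exists2 I : R, 0 < I &
    (\int[mu]_x (`|x : R| ^+ n * expR (- (x : R) ^+ 2))%:E = I%:E)%E.
Proof.
have [disp [T [P [X [mX XA [C C0 XC]]]]]] := @gauss_space R n.
have spi : 0 < Num.sqrt pi ^+ n.+1 :> R by rewrite exprn_gt0// sqrtr_gt0 pi_gt0.
have e0 (x : R) : (0 <= (expR (- x ^+ 2))%:E)%E by rewrite lee_fin expR_ge0.
have := XC _ measurable_gauss e0.
(* Taking [f = 1] reduces the formula for linear forms to the total Gaussian mass, whatever [v]
   is. *)
have := XA (fun _ => 0) (fun=> 1%E) (measurable_cst _) (fun _ => lee01).
under eq_integral do rewrite mul1e.
under [in X in _ = (_ * X)%E -> _]eq_integral do rewrite mul1e.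
rewrite integral_gauss -EFinM -exprSr => E1.
rewrite (eq_integral (fun w => (expR (- \sum_(i < n.+1) X i w ^+ 2))%:E)); last first.
  by move=> w _; rewrite sqr_sqrtr// sumr_ge0// => i _; exact: sqr_ge0.
rewrite E1; under eq_integral do rewrite real_normK ?num_real// -EFinM mulrC.
set I := (\int[mu]_x _)%E => E2.
have I0 : (0 <= I)%E.
  by apply: integral_ge0 => x _; rewrite lee_fin mulr_ge0 ?exprn_ge0 ?expR_ge0.
move: I I0 E2 => [r| |]//.
- rewrite lee_fin le_eqVlt => /predU1P[<-|r0 _]; last by exists r.
  by rewrite mule0 => -[] /eqP; rewrite gt_eqF.
(* If [I = +oo], then [C * I] is 0 or [+oo] according to whether [C] vanishes. *)
- move=> _ E2; exfalso; move: C0 E2; rewrite le_eqVlt => /predU1P[<-|C0].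
    by rewrite mul0e => -[] /eqP; rewrite gt_eqF.
  by rewrite gt0_muley.
Qed.

Lemma Gamma_half_gt0 (n : nat) : 0 < Gamma (n.+1%:R / 2 : R).
Proof.
have [I I0] := integral_normX_gauss_pos n.
by rewrite integral_normX_gauss /Gamma /Rintegral => ->.
Qed.

(** [Gamma] is [fine] of an extended integral; nothing is lost because that integral is finite. *)
Lemma integral_normX_gauss_Gamma (n : nat) :
  (\int[mu]_x (`|x : R| ^+ n * expR (- (x : R) ^+ 2))%:E =
   (Gamma (n.+1%:R / 2 : R))%:E)%E.
Proof.
have [I I0 IE] := integral_normX_gauss_pos n.
by rewrite IE /Gamma /Rintegral -integral_normX_gauss IE.
Qed.

(** Here [w] is the Gaussian density without normalization. The second integral divided by the first
    is [alpha_cst R n.+1] times the norm of [v]. *)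
Lemma gauss_moments (n : nat) :
  exists (disp : measure_display) (T : measurableType disp)
    (P : {measure set T -> \bar R}) (X : 'I_n.+1 -> T -> R) (w : T -> R),
  [/\ forall t, 0 <= w t,
      P.-integrable setT (fun t => (Num.sqrt (\sum_(i < n.+1) X i t ^+ 2) * w t)%:E) /\
      \int[P]_t (Num.sqrt (\sum_(i < n.+1) X i t ^+ 2) * w t) =
        Num.sqrt pi ^+ n.+1 * (Gamma (n.+2%:R / 2) / Gamma (n.+1%:R / 2))
    & forall v : 'I_n.+1 -> R,
      P.-integrable setT (fun t => (`|\sum_(i < n.+1) v i * X i t| * w t)%:E) /\
      \int[P]_t (`|\sum_(i < n.+1) v i * X i t| * w t) =
        Num.sqrt pi ^+ n * Num.sqrt (\sum_(i < n.+1) v i ^+ 2)].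
Proof.
have [disp [T [P [X [mX XA [C C0 XC]]]]]] := @gauss_space R n.
pose w t := expR (- \sum_(i < n.+1) X i t ^+ 2).
have w0 t : 0 <= w t by exact: expR_ge0.
have ms : measurable_fun setT (fun t => \sum_(i < n.+1) X i t ^+ 2).
  by apply: measurable_sum => i; exact: measurable_funX.
have mw : measurable_fun setT w.
  by apply: measurableT_comp => //; exact: measurableT_comp.
have int_of (f : T -> R) (r : R) : measurable_fun setT f -> (forall t, 0 <= f t) ->
    (\int[P]_t (f t)%:E = r%:E)%E ->
    P.-integrable setT (fun t => (f t)%:E) /\ \int[P]_t f t = r.
  move=> mf f0 fr; split; last by rewrite /Rintegral fr.
  apply/integrableP; split; first exact/measurable_EFinP.
  by under eq_integral do rewrite gee0_abs ?lee_fin//; rewrite fr ltry.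
have e0 (x : R) : (0 <= (expR (- x ^+ 2))%:E)%E by rewrite lee_fin expR_ge0.
have sqK t : Num.sqrt (\sum_(i < n.+1) X i t ^+ 2) ^+ 2 = \sum_(i < n.+1) X i t ^+ 2.
  by rewrite sqr_sqrtr// sumr_ge0// => i _; exact: sqr_ge0.
(* The total Gaussian mass, computed in two ways, determines [C]. *)
have CE : (C * (Gamma (n.+1%:R / 2 : R))%:E = (Num.sqrt pi ^+ n.+1)%:E)%E.
  have := XC _ measurable_gauss e0.
  have := XA (fun _ => 0) (fun=> 1%E) (measurable_cst _) (fun _ => lee01).
  under eq_integral do rewrite mul1e.
  under [in X in _ = (_ * X)%E -> _]eq_integral do rewrite mul1e.
  rewrite integral_gauss -EFinM -exprSr => E1.
  rewrite (eq_integral (fun t => (expR (- \sum_(i < n.+1) X i t ^+ 2))%:E)); last first.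
    by move=> t _; rewrite sqK.
  rewrite E1 => ->; congr (_ * _)%E; rewrite -integral_normX_gauss_Gamma.
  by apply: eq_integral => x _; rewrite real_normK ?num_real// -EFinM mulrC.
have G0 := Gamma_half_gt0 n.
have {}CE : C = (Num.sqrt pi ^+ n.+1 / Gamma (n.+1%:R / 2))%:E.
  by rewrite EFinM -CE -muleA -EFinM divff ?mule1 ?gt_eqF.
have m1 : measurable_fun setT (fun x : R => `|x|%:E).
  by apply/measurable_EFinP; exact: normr_measurable.
exists disp, T, P, X, w; split=> //.
- apply: int_of.
  + by apply: measurable_funM => //; apply: measurableT_comp => //; exact: measurable_sqrt.
  + by move=> t; rewrite mulr_ge0 ?sqrtr_ge0.
  (* The extra factor [|x|] turns the exponent [n] into [n.+1], hence the Gamma argument into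
     [n.+2%:R / 2]. *)
  pose f (x : R) := (`|x| * expR (- x ^+ 2))%:E.
  have mf : measurable_fun setT f.
    apply/measurable_EFinP/measurable_funM; first exact: normr_measurable.
    exact: measurable_gauss_fun.
  have f0 x : (0 <= f x)%E by rewrite lee_fin mulr_ge0 ?expR_ge0.
  transitivity (\int[P]_t f (Num.sqrt (\sum_(i < n.+1) X i t ^+ 2)))%E.
    by apply: eq_integral => t _; rewrite /f sqK ger0_norm ?sqrtr_ge0.
  rewrite (XC _ mf f0) CE [in RHS]mulrA [in RHS]mulrAC [in RHS]EFinM; congr (_ * _)%E.
  rewrite -integral_normX_gauss_Gamma; apply: eq_integral => x _.
  by rewrite /f normr_id real_normK ?num_real// -EFinM mulrAC -exprS.
- move=> v; apply: int_of.
  + apply: measurable_funM => //; apply: measurableT_comp => //.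
    by apply: measurable_sum => i; exact: measurable_funM.
  + by move=> t; rewrite mulr_ge0.
  have := XA v _ m1 (fun x => normr_ge0 x).
  under eq_integral do rewrite -EFinM.
  move=> ->; rewrite EFinM; congr (_ * _)%E.
  set s := Num.sqrt _; have s0 : 0 <= s by exact: sqrtr_ge0.
  (* The scale [s] comes out, leaving the integral of [|t| exp (- t^2)], which is [Gamma 1 = 1]. *)
  transitivity (\int[mu]_t (s%:E * (`|t : R| ^+ 1 * expR (- (t : R) ^+ 2))%:E))%E.
    by apply: eq_integral => t _; rewrite -!EFinM normrM (ger0_norm s0) expr1 mulrA.
  rewrite ge0_integralZl//; last first.
    apply/measurable_EFinP/measurable_funM; first exact: measurable_normX.
    exact: measurable_gauss_fun.
  by rewrite integral_normX_gauss_Gamma divff// Gamma1 mule1.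
Qed.
End gamma.

(** * Kernels on the ball *)

Lemma half_dist_ball_schur {R : realType} (n N : nat) (B : 'I_N -> 'I_N -> R)
    (x : 'I_N -> 'rV[R]_n.+1) :
  (forall c : 'I_N -> R, 0 <= \sum_(i < N) \sum_(j < N) c i * c j * B i j) ->
  (forall i, half_ball R n.+1 (x i)) ->
  0 <= \sum_(i < N) \sum_(j < N)
         B i j * (1 / 2 - alpha_cst R n.+1 * Defs.edist (x i) (x j)).
Proof.
move=> B0 xb.
have [disp [T [P [X [w [w0 [iM EM] iv]]]]]] := @gauss_moments R n.
have G1 := @Gamma_half_gt0 R n; have G2 := @Gamma_half_gt0 R n.+1.
have spi : 0 < Num.sqrt pi :> R by rewrite sqrtr_gt0 pi_gt0.
pose xi t : 'rV[R]_n.+1 := \row_i X i t.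
have xiE t : Num.sqrt (\sum_(i < n.+1) X i t ^+ 2) = enorm (xi t).
  by congr Num.sqrt; apply: eq_bigr => i _; rewrite !mxE expr2.
pose h i j t := `|\sum_(k < n.+1) (x i - x j) ord0 k * X k t| * w t.
have hE i j t : h i j t = `|inner (x i) (xi t) - inner (x j) (xi t)| * w t.
  rewrite /h -sumrB; congr (`|_| * _); apply: eq_bigr => k _.
  by rewrite !mxE mulrBl.
pose M t := Num.sqrt (\sum_(i < n.+1) X i t ^+ 2) * w t.
have iM2 : P.-integrable setT (EFin \o (fun t => 2^-1 * M t)).
  by have := integrableZl measurableT 2^-1 iM.
have ik i j : P.-integrable setT (EFin \o (fun t => 2^-1 * M t - h i j t)).
  by have := integrableB measurableT iM2 (iv (fun k => (x i - x j) ord0 k)).1.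
(* Factoring out the integral of [|X|] leaves the quotient of the two moments, which is the constant
   [alpha_cst]. *)
have kE i j : \int[P]_t (2^-1 * M t - h i j t) =
    Num.sqrt pi ^+ n.+1 * (Gamma (n.+2%:R / 2) / Gamma (n.+1%:R / 2)) *
    (1 / 2 - alpha_cst R n.+1 * Defs.edist (x i) (x j)).
  have [ih Eh] := iv (fun k => (x i - x j) ord0 k).
  rewrite RintegralB// RintegralZl// EM Eh.
  have -> : Num.sqrt (\sum_(k < n.+1) (x i - x j) ord0 k ^+ 2) = Defs.edist (x i) (x j).
    by congr Num.sqrt; apply: eq_bigr => k _; rewrite expr2.
  rewrite /alpha_cst exprSr; field.
  by rewrite !gt_eqF.
set c := Num.sqrt pi ^+ n.+1 * _ in kE.
have c0 : 0 < c by rewrite mulr_gt0 ?exprn_gt0 ?divr_gt0.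
rewrite -(pmulr_rge0 _ c0) mulr_sumr.
under eq_bigr do rewrite mulr_sumr.
under eq_bigr do under eq_bigr do rewrite mulrCA -kE.
apply: ge0_sum_Rintegral => // t _.
have -> : \sum_(i < N) \sum_(j < N) B i j * (2^-1 * M t - h i j t) =
    (\sum_(i < N) \sum_(j < N) B i j *
       (enorm (xi t) / 2 - `|inner (x i) (xi t) - inner (x j) (xi t)|)) * w t.
  rewrite mulr_suml; apply: eq_bigr => i _; rewrite mulr_suml.
  by apply: eq_bigr => j _; rewrite hE /M xiE; ring.
rewrite mulr_ge0//; apply: half_dist_schur => // i.
(* The radius of the ball enters here: [|<x_i, X>| <= |x_i| |X| <= |X| / 2]. *)
apply: le_trans (inner_CauchySchwarz _ _) _.
have xi0 : 0 <= enorm (xi t) by exact: sqrtr_ge0.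
by rewrite [leRHS]mulrC ler_wpM2r// -div1r ltW//; exact: xb.
Qed.

(** The set [Y] and the function [dist] are arbitrary, so that the Euclidean and the spherical case
    are both instances. *)
Lemma positive_definite_phi_of {R : realType} {T : Type} (d : nat)
    (Y : set T) (dist : T -> T -> R) (alpha : R -> R) :
  (0 < d)%N -> alpha 0 = 1 ->
  positive_definite Y (fun y y' => alpha (dist y y')) ->
  positive_definite (half_ball R d `*` Y)
    (fun p q => phi_of d alpha (Defs.edist p.1 q.1) (dist p.2 q.2)).
Proof.
case: d => // n _ alpha0 Yalpha N a p Xp.
(* The coefficients are absorbed into the matrix: its form at [c] is the form of [alpha] at the
   products [c i * a i]. *)
pose B i j := a i * a j * alpha (dist (p i).2 (p j).2).
have B0 (c : 'I_N -> R) : 0 <= \sum_(i < N) \sum_(j < N) c i * c j * B i j.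
  have := Yalpha N (fun i => c i * a i) (fun i => (p i).2) (fun i => (Xp i).2).
  move=> h; apply: (le_trans h); rewrite le_eqVlt; apply/orP; left; apply/eqP.
  by apply: eq_bigr => i _; apply: eq_bigr => j _; rewrite /B; ring.
have := half_dist_ball_schur B0 (fun i => (Xp i).1).
set S := \sum_(i < N) _ => S0.
(* The constant 1 in the numerator contributes the square of the sum of the [a i], the rest is [S],
   and the denominator is [3 / 2]. *)
suff -> : \sum_(i < N) \sum_(j < N) a i * a j *
    phi_of n.+1 alpha (Defs.edist (p i).1 (p j).1) (dist (p i).2 (p j).2) =
    ((\sum_(i < N) a i) ^+ 2 + S) / (1 + alpha 0 / 2).
  by rewrite divr_ge0 ?addr_ge0 ?sqr_ge0// alpha0.
rewrite expr2 mulr_suml -big_split mulr_suml; apply: eq_bigr => i _ /=.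
rewrite mulr_sumr -big_split mulr_suml; apply: eq_bigr => j _ /=.
by rewrite /phi_of /B; ring.
Qed.

Lemma continuous_phi_of {R : realType} (d : nat) (I D : set R) (alpha : R -> R) :
  {within D, continuous alpha} ->
  {within I `*` D, continuous (fun xt : R * R => phi_of d alpha xt.1 xt.2)}.
Proof.
move=> /subspace_continuousP calpha; apply/subspace_continuousP => -[x t] [/= Ix Dt].
have c2 : alpha xt.2 @[xt --> within (I `*` D) (nbhs (x, t))] --> alpha t.
  apply: cvg_trans (calpha t Dt).
  (* Since [alpha] is continuous only within [D], the condition on the second coordinate is imposed
     only at points of [D]; no restriction is put on the first. *)
  move=> U tU; exists (setT, [set s | D s -> U (alpha s)]) => /=.
    by split=> //; exact: filterT.
  by move=> [y s] [/= _ sU] [_ Ds]; exact: sU.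
have c1 : xt.1 @[xt --> within (I `*` D) (nbhs (x, t))] --> x.
  by apply: cvg_within_filter; exact: cvg_fst.
apply: cvgM; last exact: cvg_cst.
apply: cvgD; first exact: cvg_cst.
apply: cvgM => //; apply: cvgB; first exact: cvg_cst.
by apply: cvgM => //; exact: cvg_cst.
Qed.

Lemma phi_of00 {R : realType} (d : nat) (alpha : R -> R) :
  alpha 0 = 1 -> phi_of d alpha 0 0 = 1.
Proof.
by move=> a0; rewrite /phi_of a0 mulr0 subr0 mul1r -[2^-1]mul1r divff// gt_eqF.
Qed.

Theorem mainTheorem6 (R : realType) (d d' : nat)
    (hd : (0 < d)%N) (hd' : (0 < d')%N) :
  (forall alpha : R -> R,
     P_euclid d' alpha -> P_ball_euclid d d' (phi_of d alpha)) /\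
  (forall alpha : R -> R,
     P_sphere d' alpha -> P_ball_sphere d d' (phi_of d alpha)).
Proof.
split=> alpha [calpha alpha0 pdalpha]; split.
- exact: continuous_phi_of.
- exact: phi_of00.
- exact: (positive_definite_phi_of (dist := Defs.edist)).
- exact: continuous_phi_of.
- exact: phi_of00.
- exact: (positive_definite_phi_of (dist := geodist)).
Qed.
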